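(* Let $W\colon\mathbb R^d\to\mathbb R$ be a Borel function satisfying $$W(x)\le0\ \text{ for all }x\in\mathbb R^d\qquad\text{and}\qquad\lim_{|x|\to+\infty}W(x)=0.$$ For $\varepsilon>0$ and $u\in H^1((0,1);\mathbb R^d)$ let $$G_\varepsilon(u)=\int_0^1\Big(|u'(t)|^2+W\Big(\frac{u(t)}\varepsilon\Big)\Big)dt.$$ Then, for $u\in H^1((0,1);\mathbb R^d)$, $$\Gamma\text{-}\lim_{\varepsilon\to0}G_\varepsilon(u)=\int_0^1|u'(t)|^2\,dt+(\inf W)\,\big|\{t:u(t)=0\}\big|.$$
   Context: Here $d\ge1$ is an integer, $\inf W$ is the infimum of $W$ over $\mathbb R^d$, $\{t:u(t)=0\}$ is the set of $t\in(0,1)$ with $u(t)=0$ (for the continuous representative of $u$), and $|A|$ denotes the Lebesgue measure of $A\subset\mathbb R$. $\Gamma$-limits are computed on $H^1((0,1);\mathbb R^d)$ with respect to its weak topology (or, in the paper's convention, equivalently with respect to the strong topology of $L^2$). That is, $\Gamma\text{-}\lim_{\varepsilon\to0}E_\varepsilon=E$ means: (liminf) for every $u$ and every $u_\varepsilon\rightharpoonup u$ weakly in $H^1$ one has $E(u)\le\liminf_{\varepsilon\to0}E_\varepsilon(u_\varepsilon)$; (limsup) for every $u$ there exists $u_\varepsilon\rightharpoonup u$ weakly in $H^1$ with $\limsup_{\varepsilon\to0}E_\varepsilon(u_\varepsilon)\le E(u)$.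
   Formalization: The formula is stated only where the product (inf W)|{t:u(t)=0}| is defined, i.e. excluding inf W = −∞ together with |{t:u(t)=0}| = 0, where no fixed value of (−∞)·0 makes the claim true. *)

(* Defs.v *)
From HB Require Import structures.
From mathcomp Require Import all_boot all_order all_algebra.
From mathcomp Require Import all_classical all_reals all_analysis.

Set Implicit Arguments.
Unset Strict Implicit.
Unset Printing Implicit Defensive.

Import Order.TTheory GRing.Theory Num.Theory.
Import numFieldNormedType.Exports.

Local Open Scope classical_set_scope.
Local Open Scope ring_scope.

(* The Euclidean norm; the library's [`|v|] on row vectors is the max norm. *)
Definition enorm {R : realType} {d : nat} (v : 'rV[R]_d) : R :=
  Num.sqrt (\sum_(i < d) v ord0 i ^+ 2).

(* Borel functions on R^d, for the Borel sigma-algebra of the usual topology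
   (the library puts no measurable structure on row vectors). *)
Definition borel_fun {R : realType} {d : nat} (W : 'rV[R]_d -> R) : Prop :=
  forall B : set R, measurable B -> <<s @open 'rV[R]_d >> (W @^-1` B).

Definition vanishes_at_infinity {R : realType} {d : nat}
    (W : 'rV[R]_d -> R) : Prop :=
  forall e : R, 0 < e ->
    exists M : R, forall x : 'rV[R]_d, M < enorm x -> `|W x| < e.

Definition I01 {R : realType} : set R := `]0, 1[%classic.

(* Elements of L^2 and H^1 are represented by functions [R -> 'rV_d], of which
   only the restriction to (0,1), up to null sets, matters. *)
Definition L2 {R : realType} {d : nat} (u : R -> 'rV[R]_d) : Prop :=
  forall i : 'I_d,
    measurable_fun I01 (fun t => u t ord0 i) /\
    (@lebesgue_measure R).-integrable I01 (fun t => (u t ord0 i ^+ 2)%:E).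

(* C^1_c(0,1) *)
Definition test_fun {R : realType} (phi : R -> R) : Prop :=
  [/\ forall t, derivable phi t 1,
      continuous (derive1 phi) &
      exists K : set R, [/\ compact K, K `<=` I01 &
                            forall t, ~ K t -> phi t = 0] ].

Definition is_weak_derivative {R : realType} {d : nat}
    (u g : R -> 'rV[R]_d) : Prop :=
  L2 g /\
  forall (phi : R -> R) (i : 'I_d), test_fun phi ->
    \int[lebesgue_measure]_(t in I01) (u t ord0 i * derive1 phi t) =
    - \int[lebesgue_measure]_(t in I01) (g t ord0 i * phi t).

Definition H1 {R : realType} {d : nat} (u : R -> 'rV[R]_d) : Prop :=
  L2 u /\ exists g, is_weak_derivative u g.

(* A choice of u', which is unique up to null sets of (0,1). *)
Definition weak_derivative {R : realType} {d : nat}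
    (u : R -> 'rV[R]_d) : R -> 'rV[R]_d :=
  xget (fun=> 0) [set g | is_weak_derivative u g].

(* The continuous representative, unique on (0,1). *)
Definition continuous_repr {R : realType} {d : nat}
    (u : R -> 'rV[R]_d) : R -> 'rV[R]_d :=
  xget (fun=> 0) [set v | (forall t, I01 t -> {for t, continuous v}) /\
                          ae_eq lebesgue_measure I01 u v].

Definition H1norm {R : realType} {d : nat} (u : R -> 'rV[R]_d) : R :=
  Num.sqrt (\int[lebesgue_measure]_(t in I01) (enorm (u t) ^+ 2) +
            \int[lebesgue_measure]_(t in I01)
              (enorm (weak_derivative u t) ^+ 2)).

(* Continuous linear functionals on H^1. Boundedness makes [L] invariant under
   modification of its argument on null sets. *)
Definition H1_dual {R : realType} {d : nat}
    (L : (R -> 'rV[R]_d) -> R) : Prop :=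
  (forall (a : R) (u v : R -> 'rV[R]_d), H1 u -> H1 v ->
     L (a *: u + v) = a * L u + L v) /\
  exists C : R, forall u, H1 u -> `|L u| <= C * H1norm u.

(* Weak convergence in H^1 of a family indexed by eps > 0, as eps -> 0. *)
Definition H1_weak_cvg {R : realType} {d : nat}
    (ueps : R -> R -> 'rV[R]_d) (u : R -> 'rV[R]_d) : Prop :=
  forall L, H1_dual L -> L (ueps eps) @[eps --> 0^'+] --> L u.

(* [l] is the value at [u] of the Gamma-limit, as eps -> 0, of the functionals
   [E eps] on H^1 with its weak topology. *)
Definition is_Gamma_lim_at {R : realType} {d : nat}
    (E : R -> (R -> 'rV[R]_d) -> \bar R) (u : R -> 'rV[R]_d) (l : \bar R)
    : Prop :=
  (forall ueps : R -> R -> 'rV[R]_d,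
     (forall eps, 0 < eps -> H1 (ueps eps)) -> H1_weak_cvg ueps u ->
     (l <= limf_einf (fun eps => E eps (ueps eps)) 0^'+)%E) /\
  (exists ueps : R -> R -> 'rV[R]_d,
     [/\ forall eps, 0 < eps -> H1 (ueps eps), H1_weak_cvg ueps u &
         (limf_esup (fun eps => E eps (ueps eps)) 0^'+ <= l)%E]).

(* Extended-real valued: W is not assumed to be bounded below. *)
Definition Geps {R : realType} {d : nat} (W : 'rV[R]_d -> R) (eps : R)
    (u : R -> 'rV[R]_d) : \bar R :=
  (\int[lebesgue_measure]_(t in I01)
     (enorm (weak_derivative u t) ^+ 2 + W (eps^-1 *: u t))%:E)%E.

Definition infW {R : realType} {d : nat} (W : 'rV[R]_d -> R) : \bar R :=
  ereal_inf [set (W x)%:E | x in [set: 'rV[R]_d]].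

Definition zero_set {R : realType} {d : nat} (u : R -> 'rV[R]_d) : set R :=
  [set t | I01 t /\ continuous_repr u t = 0].

(* Main.v *)
Require Import Defs.
From mathcomp Require Import all_boot all_order all_algebra.
From mathcomp Require Import all_classical all_reals all_analysis.
From mathcomp Require Import measurable_realfun ring lra.

Set Implicit Arguments.
Unset Strict Implicit.
Unset Printing Implicit Defensive.

Import Order.TTheory GRing.Theory Num.Theory.
Import numFieldNormedType.Exports.
Local Open Scope classical_set_scope.
Local Open Scope ring_scope.

(** In one dimension weak convergence in [H1] forces pointwise convergence of the
    continuous representatives: evaluation at a point is a bounded linear
    functional ([H1_dual_eval]), by the Sobolev embedding. Pairing [u'] with a fixed
    square integrable function is another one ([H1_dual_pairing]), and these two
    suffice for the lower bound.

    Lower bound ([liminf_inequality]). Let [m] be the infimum of [W], assumed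
    finite, and let [u_eps] tend weakly to [u]. Where [u t] is nonzero,
    [u_eps t / eps] escapes to infinity, so that [W (u_eps t / eps)] tends to
    [0]; as [W] is bounded, dominated convergence kills the contribution of that
    set. On the zero set of [u] one has [W >= m]. The gradient term is bounded
    below by the affine functional [2 u' . u_eps' - |u'| ^ 2], whose integral
    converges to that of [|u'| ^ 2]. If the infimum is [-oo], then the zero set
    has positive measure (the formula would otherwise be undefined), the claimed
    limit is [-oo] and there is nothing to prove.

    Upper bound ([limsup_inequality]). Take [u_eps = u + eps y_eps], where [y_eps]
    nearly minimizes [W] among the vectors with [|y_eps| ^ 2 <= eps ^-1]. The
    constraint makes [eps y_eps] tend to [0], the derivative of [u_eps] is that of
    [u], and on the zero set of [u] the potential term is exactly [W y_eps], whose
    upper limit is the infimum of [W]; elsewhere [W <= 0] is enough.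

    Both parts rest on the existence and uniqueness theory of [u'] and of the
    continuous representative. It is obtained by testing the weak derivative with
    a smoothed indicator of [[a, b]]: when the smoothing scale tends to [0], the
    defining identity becomes [u b - u a = \int_a^b u'] for all Lebesgue points
    [a < b] of [u] ([weak_deriv_increment]). *)

(** * Almost everywhere statements and integrals on the unit interval *)

Section UnitInterval.
Context {R : realType}.
Notation mu := (@lebesgue_measure R).
Implicit Types (f g F : R -> R) (a t : R).

Lemma measurable_I01 : measurable (I01 : set (measurableTypeR R)).
Proof. exact: measurable_itv. Qed.
Hint Resolve measurable_I01 : core.

Lemma mu_I01 : mu I01 = 1%E.
Proof. by rewrite lebesgue_measure_itv /= lte_fin ltr01 sube0. Qed.

Lemma I01_nbhs t : I01 t -> \forall s \near t, I01 s.
Proof. by move=> It; apply: open_nbhs_nbhs; split=> //; exact: interval_open. Qed.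

Lemma ball_sub_not_negligible (A : set R) a (e : R) : 0 < e -> ball a e `<=` A ->
  ~ mu.-negligible A.
Proof.
move=> e0 eA nA; have : mu.-negligible (ball a e) by apply: negligibleS nA.
have mB : measurable (ball a e : set (measurableTypeR R)) by exact: measurable_ball.
move/(negligibleP mu mB) => B0.
have : (e *+ 2)%:E = 0%E by rewrite -(lebesgue_measure_ball a (ltW e0)).
by apply/eqP; rewrite eqe mulrn_eq0 /= gt_eqF.
Qed.

Lemma aeS (P Q : R -> Prop) : (forall t, P t -> Q t) ->
  {ae mu, forall t, P t} -> {ae mu, forall t, Q t}.
Proof. by move=> PQ; apply: negligibleS => t /= nQ /PQ. Qed.

Lemma ae_and (P Q : R -> Prop) : {ae mu, forall t, P t} -> {ae mu, forall t, Q t} ->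
  {ae mu, forall t, P t /\ Q t}.
Proof. exact: (@filterI R _ (ae_filter_ringOfSetsType mu)). Qed.

Lemma ae_forall (I : finType) (P : I -> R -> Prop) :
  (forall i, {ae mu, forall t, P i t}) -> {ae mu, forall t, forall i, P i t}.
Proof. exact: (@filter_forall R I P _ (ae_filter_ringOfSetsType mu)). Qed.

Lemma ae_eq_Rintegral f g : measurable_fun I01 f -> measurable_fun I01 g ->
  ae_eq mu I01 f g -> \int[mu]_(t in I01) f t = \int[mu]_(t in I01) g t.
Proof.
move=> mf mg fg; congr fine; apply: ae_eq_integral => //; [exact/measurable_EFinP..|].
by apply: aeS fg => t + It => /(_ It) ->.
Qed.

(** The energies may be [-oo] when [W] is unbounded below, so that the comparison is
    made separately on positive and negative parts. *)
Lemma ae_le_integral (f g : R -> \bar R) :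
  measurable_fun I01 f -> measurable_fun I01 g ->
  {ae mu, forall t, I01 t -> (f t <= g t)%E} ->
  (\int[mu]_(t in I01) f t <= \int[mu]_(t in I01) g t)%E.
Proof.
move=> mf mg fg.
(* [g] is a.e. equal to a function that lies above [f] everywhere. *)
pose h t := maxe (f t) (g t).
have mh : measurable_fun I01 h by exact: measurable_maxe.
have -> : (\int[mu]_(t in I01) g t = \int[mu]_(t in I01) h t)%E.
  apply: ae_eq_integral => //.
  by apply: aeS fg => t + It => /(_ It) H; apply/esym/max_idPr.
rewrite integralE [leRHS]integralE; apply: leeB; apply: ge0_le_integral => //.
- exact: measurable_funepos.
- exact: measurable_funepos.
- by move=> t It; apply: (@funepos_le _ _ I01 f h); rewrite ?inE// => s _; rewrite /h le_max lexx.
- exact: measurable_funeneg.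
- exact: measurable_funeneg.
- by move=> t It; apply: (@funeneg_le _ _ I01 f h); rewrite ?inE// => s _; rewrite /h le_max lexx.
Qed.

Lemma integrable_finsum (I : finType) (F : I -> R -> R) :
  (forall i, mu.-integrable I01 (EFin \o F i)) ->
  mu.-integrable I01 (fun t => (\sum_i F i t)%:E).
Proof.
move=> IF.
have : mu.-integrable I01 (fun t => \sum_(i <- index_enum I) (F i t)%:E)%E.
  by apply: integrable_sum => // i _; exact: IF.
by apply: eq_integrable => // t _; rewrite sumEFin.
Qed.

Lemma Rintegral_finsum (I : finType) (F : I -> R -> R) :
  (forall i, mu.-integrable I01 (EFin \o F i)) ->
  \int[mu]_(t in I01) (\sum_i F i t) = \sum_i \int[mu]_(t in I01) F i t.
Proof.
move=> IF; rewrite /Rintegral.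
have -> : (\int[mu]_(t in I01) (\sum_i F i t)%:E =
   \sum_(i <- index_enum I) \int[mu]_(t in I01) (F i t)%:E)%E.
  rewrite -integral_sum//.
  by apply: eq_integral => t _; rewrite sumEFin.
by rewrite -sum_fine// => i _; apply: integrable_fin_num => //; exact: IF.
Qed.

Lemma Rintegral_I01_cst (c : R) : \int[mu]_(t in I01) c = c.
Proof.
rewrite Rintegral_cst//; have -> : fine (mu I01) = 1 by rewrite mu_I01.
by rewrite mulr1.
Qed.

Lemma continuous_integrable_I01 f : continuous f -> mu.-integrable I01 (EFin \o f).
Proof.
move=> cf; have : mu.-integrable `[0, 1] (EFin \o f).
  apply: continuous_compact_integrable; first exact: segment_compact.
  exact: continuous_subspaceT.
by apply: integrableS => //; exact: subset_itv_oo_cc.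
Qed.

Lemma Rintegral_I01_FTC f F : continuous f -> (forall t, is_derive t 1 F (f t)) ->
  \int[mu]_(t in I01) f t = F 1 - F 0.
Proof.
move=> cf dF.
have If : mu.-integrable `[0, 1] (EFin \o f).
  apply: continuous_compact_integrable; first exact: segment_compact.
  exact: continuous_subspaceT.
have cF : continuous F.
  move=> t; apply: differentiable_continuous; apply/derivable1_diffP.
  by case: (dF t).
rewrite [LHS]Rintegral_itv_bndo_bndc; last first.
  by apply: integrableS If => //; exact: subset_itv_oo_cc.
rewrite Rintegral_itv_obnd_cbnd//; last first.
  by apply: integrableS If => //; exact: subset_itv_oc_cc.
rewrite /Rintegral (@continuous_FTC2 _ f F)//=.
- exact: continuous_subspaceT.
- split; first by move=> x _; case: (dF x).
  + by apply: cvg_at_right_filter; exact: cF.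
  + by apply: cvg_at_left_filter; exact: cF.
- by move=> x _; rewrite derive1E; have H := dF x; apply: derive_val.
Qed.

End UnitInterval.
#[global] Hint Resolve measurable_I01 : core.

(** * Square integrable functions *)

Section SquareIntegrable.
Context {R : realType}.
Notation mu := (@lebesgue_measure R).
Implicit Types f g : R -> R.

Definition sqint f :=
  measurable_fun (@I01 R) f /\ mu.-integrable I01 (fun t => (f t ^+ 2)%:E).

Lemma sqint_bounded f C : measurable_fun I01 f ->
  (forall t, I01 t -> `|f t| <= C) -> sqint f.
Proof.
move=> mf fC; split=> //.
apply: (@measurable_bounded_integrable _ _ _ mu (fun t => f t ^+ 2)) => //.
- by have := ltry (1 : R); rewrite -mu_I01; apply.
- exact: measurable_funX.
- exists (C ^+ 2); split; first by rewrite num_real.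
  move=> x Cx t It /=; apply: le_trans (ltW Cx).
  by rewrite normrX lerXn2r ?nnegrE ?fC// (le_trans _ (fC t It)).
Qed.

Lemma sqint_cst (c : R) : sqint (cst c).
Proof. by apply: (@sqint_bounded _ `|c|). Qed.

Lemma sqint_continuous f : continuous f -> sqint f.
Proof.
move=> cf; split; first by apply: measurable_funTS; exact: continuous_measurable_fun.
by apply: (@continuous_integrable_I01 _ (fun t => f t ^+ 2)) => t; apply: cvgM; exact: cf.
Qed.

Lemma sqint_norm f : sqint f -> sqint (fun t => `|f t|).
Proof.
move=> [mf If]; split; first exact: measurableT_comp.
by apply: eq_integrable If => // t _; rewrite real_normK ?num_real.
Qed.

Lemma sqint_mul f g : sqint f -> sqint g ->
  mu.-integrable I01 (fun t => (f t * g t)%:E).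
Proof.
move=> [mf If] [mg Ig].
apply: (le_integrable _ _ _ (integrableD _ If Ig)) => //.
  by apply/measurable_EFinP; exact: measurable_funM.
move=> t _ /=; rewrite lee_fin [leRHS]ger0_norm ?addr_ge0 ?sqr_ge0//.
rewrite normrM -(real_normK (num_real (f t))) -(real_normK (num_real (g t))).
have := normr_ge0 (f t); have := normr_ge0 (g t).
by move: `|f t| `|g t| => x y; nra.
Qed.

Lemma sqint_scale (a : R) f : sqint f -> sqint (fun t => a * f t).
Proof.
move=> [mf If]; split; first exact: measurable_funM.
apply: eq_integrable (integrableZl _ (a ^+ 2) If) => //.
by move=> t _; rewrite -EFinM exprMn.
Qed.

Lemma sqint_add f g : sqint f -> sqint g -> sqint (fun t => f t + g t).
Proof.
move=> Lf Lg; have [mf If] := Lf; have [mg Ig] := Lg.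
split; first exact: measurable_funD.
have Ifg := integrableZl measurable_I01 2 (sqint_mul Lf Lg).
apply: eq_integrable (integrableD _ (integrableD _ If Ig) Ifg) => //.
by move=> t _ /=; rewrite -EFinM -!EFinD; congr EFin; ring.
Qed.

Lemma sqint_integrable f : sqint f -> mu.-integrable I01 (EFin \o f).
Proof.
by move=> Lf; apply: eq_integrable (sqint_mul Lf (sqint_cst 1)) => // t _ /=; rewrite mulr1.
Qed.

(** The quadratic polynomial [x |-> \int (x f + g) ^ 2] is nonnegative, hence so is
    minus its discriminant. *)
Lemma Cauchy_Schwarz f g : sqint f -> sqint g ->
  `|\int[mu]_(t in I01) (f t * g t)| <=
  Num.sqrt (\int[mu]_(t in I01) (f t ^+ 2)) *
  Num.sqrt (\int[mu]_(t in I01) (g t ^+ 2)).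
Proof.
move=> Lf Lg; have [mf If] := Lf; have [mg Ig] := Lg.
have Ifg := sqint_mul Lf Lg.
set A := \int[mu]_(t in I01) (f t ^+ 2); set B := \int[mu]_(t in I01) (g t ^+ 2).
set C := \int[mu]_(t in I01) _.
have A0 : 0 <= A by apply: Rintegral_ge0 => t _; exact: sqr_ge0.
have B0 : 0 <= B by apply: Rintegral_ge0 => t _; exact: sqr_ge0.
have quad x : 0 <= x ^+ 2 * A + (2 * x) * C + B.
  have := @Rintegral_ge0 _ _ _ mu I01 (fun t => (x * f t + g t) ^+ 2)
    (fun t _ => sqr_ge0 _).
  rewrite (_ : Rintegral _ _ _ = x ^+ 2 * A + 2 * x * C + B)//.
  rewrite /A /B /C -RintegralZl// -RintegralZl// -RintegralD//.
  - rewrite -RintegralD//.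
    + by apply: eq_Rintegral => t _; ring.
    + apply: eq_integrable (integrableD _ (integrableZl _ (x ^+ 2) If)
        (integrableZl _ (2 * x) Ifg)) => //.
  - exact: eq_integrable (integrableZl _ (x ^+ 2) If).
  - exact: eq_integrable (integrableZl _ (2 * x) Ifg).
rewrite -sqrtrM// -sqrtr_sqr ler_wsqrtr//.
have [A_0|A_neq0] := eqVneq A 0.
  (* The polynomial is then affine and nonnegative, so that its slope vanishes. *)
  have [->|C0] := eqVneq C 0; first by rewrite A_0 mul0r expr0n.
  have := quad (- (B + 1) / (2 * C)).
  have -> : (2 * (- (B + 1) / (2 * C)) * C) = - (B + 1) by field.
  by rewrite A_0; lra.
(* The minimum of the polynomial is attained at [- C / A]. *)
have {}A0 : 0 < A by rewrite lt_neqAle eq_sym A_neq0.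
have := quad (- C / A).
have -> : (- C / A) ^+ 2 * A + 2 * (- C / A) * C + B = (A * B - C ^+ 2) / A by field.
by rewrite pmulr_lge0 ?invr_gt0// subr_ge0.
Qed.

Lemma Rintegral_norm_le_sqrt f : sqint f ->
  \int[mu]_(t in I01) `|f t| <= Num.sqrt (\int[mu]_(t in I01) (f t ^+ 2)).
Proof.
move=> Lf; have := Cauchy_Schwarz (sqint_norm Lf) (sqint_cst 1).
have -> : \int[mu]_(t in I01) (`|f t| * cst 1 t) = \int[mu]_(t in I01) `|f t|.
  by apply: eq_Rintegral => t _; rewrite mulr1.
have -> : \int[mu]_(t in I01) (`|f t| ^+ 2) = \int[mu]_(t in I01) (f t ^+ 2).
  by apply: eq_Rintegral => t _; rewrite real_normK ?num_real.
have -> : \int[mu]_(t in I01) ((cst 1 t) ^+ 2 : R) = 1.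
  by rewrite -[RHS]Rintegral_I01_cst; apply: eq_Rintegral => t _; rewrite /= expr1n.
by rewrite sqrtr1 mulr1; apply: le_trans; exact: ler_norm.
Qed.

End SquareIntegrable.

(** * Smoothed steps as test functions *)

Section TestFunctions.
Context {R : realType}.
Implicit Types a b h t x : R.

(** [ramp] is the [C1] primitive of [tent], going from [0] to [1] on
    [[-1, 1]]. Writing both as second differences of [posp] and of its primitive
    [halfsq] reduces differentiability to that of [halfsq]. *)
Definition posp x : R := Num.max x 0.
Definition halfsq x : R := posp x ^+ 2 / 2.
Definition tent x : R := posp (x + 1) - 2 * posp x + posp (x - 1).
Definition ramp x : R := halfsq (x + 1) - 2 * halfsq x + halfsq (x - 1).

(** The error [halfsq (x + h) - halfsq x - h posp x] is at most [h ^ 2] in absolute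
    value, uniformly in [x], so that the corner at [0] needs no separate treatment. *)
Lemma is_derive_halfsq x : is_derive x 1 halfsq (posp x).
Proof.
have cvgq : h^-1 *: (halfsq (h *: 1 + x) - halfsq x) @[h --> 0^'] --> posp x.
  apply/cvgrPdist_le => e e0; near=> h.
  have h0 : h != 0 by near: h; exact: nbhs_dnbhs_neq.
  have he : `|h| <= e.
    by near: h; apply: dnbhs0_le.
  apply: le_trans he.
  have -> : posp x - h^-1 *: (halfsq (h *: 1 + x) - halfsq x) =
      h^-1 * (h * posp x - (halfsq (h + x) - halfsq x)).
    by rewrite /GRing.scale /= mulr1 [RHS]mulrBr mulKf.
  rewrite normrM normfV ler_pdivrMl ?normr_gt0// -normrM -expr2.
  rewrite [leRHS]ger0_norm ?sqr_ge0// /halfsq /posp.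
  by case: (lerP (h + x) 0) => ?; case: (lerP x 0) => ?; rewrite ler_norml; nra.
apply: DeriveDef; first by apply/cvg_ex; exists (posp x).
by apply/cvg_lim.
Unshelve. all: by end_near. Qed.

Lemma is_derive_ramp x : is_derive x 1 ramp (tent x).
Proof.
have shift c : is_derive x 1 (fun y => halfsq (y + c)) (posp (x + c)).
  have H : is_derive (x + c) 1 halfsq (posp (x + c)) by exact: is_derive_halfsq.
  have G : is_derive x 1 (fun y : R => y + c) 1.
    by apply: is_derive_eq; rewrite addr0.
  by have := @is_derive1_comp _ halfsq (fun y => y + c) x _ _ H G; rewrite mulr1.
rewrite /ramp /tent.
have H1 := shift 1; have H2 := shift (-1).
have H0 := is_derive_halfsq x.
by apply: is_derive_eq; rewrite /GRing.scale /=; ring.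
Qed.

Lemma tent_ge0 x : 0 <= tent x.
Proof.
rewrite /tent /posp.
by case: (lerP (x + 1) 0) => ?; case: (lerP x 0) => ?; case: (lerP (x - 1) 0) => ?; lra.
Qed.

Lemma tent_le1 x : tent x <= 1.
Proof.
rewrite /tent /posp.
by case: (lerP (x + 1) 0) => ?; case: (lerP x 0) => ?; case: (lerP (x - 1) 0) => ?; lra.
Qed.

Lemma tent_out x : 1 <= `|x| -> tent x = 0.
Proof.
rewrite ler_normr => /orP H; rewrite /tent /posp.
case: (lerP (x + 1) 0) => ?; case: (lerP x 0) => ?; case: (lerP (x - 1) 0) => ?.
all: by case: H => ?; lra.
Qed.

Lemma ramp_left x : x <= -1 -> ramp x = 0.
Proof.
move=> H; rewrite /ramp /halfsq /posp.
by case: (lerP (x + 1) 0) => ?; case: (lerP x 0) => ?; case: (lerP (x - 1) 0) => ?; nra.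
Qed.

Lemma ramp_right x : 1 <= x -> ramp x = 1.
Proof.
move=> H; rewrite /ramp /halfsq /posp.
case: (lerP (x + 1) 0) => ?; case: (lerP x 0) => ?; case: (lerP (x - 1) 0) => ?; try lra.
(* The remaining case has [x - 1 <= 0], so that [x = 1]. *)
have -> : x = 1 by lra.
by field.
Qed.

Lemma ramp_ge0 x : 0 <= ramp x.
Proof.
rewrite /ramp /halfsq /posp.
by case: (lerP (x + 1) 0) => ?; case: (lerP x 0) => ?; case: (lerP (x - 1) 0) => ?; nra.
Qed.

Lemma ramp_le1 x : ramp x <= 1.
Proof.
rewrite /ramp /halfsq /posp.
by case: (lerP (x + 1) 0) => ?; case: (lerP x 0) => ?; case: (lerP (x - 1) 0) => ?; nra.
Qed.

Lemma tent_affine_continuous (c d : R) : continuous (fun y => tent ((y - c) * d)).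
Proof.
have cvg_aff (k : R) t : (y - c) * d + k @[y --> t] --> (t - c) * d + k.
  apply: cvgD; last exact: cvg_cst.
  by apply: cvgM; [apply: cvgB; [exact: cvg_id|exact: cvg_cst]|exact: cvg_cst].
have posp_aff (k : R) t : posp ((y - c) * d + k) @[y --> t] --> posp ((t - c) * d + k).
  have pospE x : posp x = (x + `|x|) / 2 by rewrite /posp maxr_absE addr0 subr0.
  under eq_fun do rewrite pospE; rewrite pospE.
  apply: cvgM; last exact: cvg_cst.
  by apply: cvgD; [exact: cvg_aff|apply: cvg_norm; exact: cvg_aff].
have posp_aff0 t : posp ((y - c) * d) @[y --> t] --> posp ((t - c) * d).
  by have := posp_aff 0 t; rewrite addr0; under eq_fun do rewrite addr0.
move=> t; rewrite /tent; apply: cvgD; first apply: cvgB.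
- exact: posp_aff.
- by apply: cvgM; [exact: cvg_cst|exact: posp_aff0].
- exact: posp_aff.
Qed.

(** As [h] tends to [0], [step a h] tends pointwise to the indicator of [t > a]
    away from [a], and its derivative [hat a h] to the Dirac mass at [a]. *)
Definition step a h t : R := ramp ((t - a) / h).
Definition hat a h t : R := h^-1 * tent ((t - a) / h).

Lemma is_derive_step a h t : is_derive t 1 (step a h) (hat a h t).
Proof.
have G : is_derive t 1 (fun y => (y - a) / h) h^-1.
  by apply: is_derive_eq; rewrite /GRing.scale /=; ring.
rewrite /hat mulrC.
exact: (@is_derive1_comp _ ramp (fun y => (y - a) / h) t _ _ (is_derive_ramp _) G).
Qed.

Lemma hat_continuous a h : continuous (hat a h).
Proof.
move=> t; apply: cvgM; first exact: cvg_cst.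
exact: tent_affine_continuous.
Qed.

Lemma hat_ge0 a h t : 0 < h -> 0 <= hat a h t.
Proof. by move=> h0; rewrite mulr_ge0 ?tent_ge0// invr_ge0 ltW. Qed.

Lemma hat_le a h t : 0 < h -> hat a h t <= h^-1.
Proof. by move=> h0; rewrite ler_piMr ?tent_le1// invr_ge0 ltW. Qed.

Lemma hat_out a h t : 0 < h -> h <= `|t - a| -> hat a h t = 0.
Proof.
move=> h0 H; rewrite /hat tent_out ?mulr0// normrM normfV (gtr0_norm h0).
by rewrite ler_pdivlMr// mul1r.
Qed.

Lemma step_left a h t : 0 < h -> t <= a - h -> step a h t = 0.
Proof. by move=> h0 H; rewrite /step ramp_left// ler_pdivrMr//; lra. Qed.

Lemma step_right a h t : 0 < h -> a + h <= t -> step a h t = 1.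
Proof. by move=> h0 H; rewrite /step ramp_right// ler_pdivlMr//; lra. Qed.

Lemma step_continuous a h : continuous (step a h).
Proof.
move=> t; apply: differentiable_continuous; apply/derivable1_diffP.
by case: (is_derive_step a h t).
Qed.

Lemma derive1_step a b h t :
  derive1 (fun t => step a h t - step b h t) t = hat a h t - hat b h t.
Proof.
have H1 := is_derive_step a h t; have H2 := is_derive_step b h t.
by rewrite derive1E; apply: derive_val.
Qed.

Lemma test_fun_step a b h : 0 < h -> a < b -> 0 < a - h -> b + h < 1 ->
  test_fun (fun t => step a h t - step b h t).
Proof.
move=> h0 ab ah bh.
split.
- move=> t; have H1 := is_derive_step a h t; have H2 := is_derive_step b h t.
  exact: derivableB.
- rewrite (_ : derive1 _ = fun t => hat a h t - hat b h t); last first.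
    by apply/funext => t; exact: derive1_step.
  by move=> t; apply: cvgB; exact: hat_continuous.
- exists `[a - h, b + h]%classic; split.
  + exact: segment_compact.
  + by move=> t /=; rewrite /I01 /= !in_itv /= => /andP[? ?]; lra.
  + move=> t /=; rewrite in_itv /= => /negP; rewrite negb_and -!ltNge => /orP[H|H].
      by rewrite !step_left//; lra.
    by rewrite !step_right//; lra.
Qed.

End TestFunctions.

(** * Weak derivatives and increments between Lebesgue points *)

Section WeakDerivative.
Context {R : realType}.
Notation mu := (@lebesgue_measure R).
Implicit Types (f g : R -> R) (a b h : R).

(** The scalar version of [is_weak_derivative], including [f] in [L2]. *)
Definition weak_deriv f g := [/\ sqint f, sqint g &
  forall phi, test_fun phi ->
    \int[mu]_(t in I01) (f t * derive1 phi t) =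
    - \int[mu]_(t in I01) (g t * phi t)].

Lemma measurable_step a h (D : set R) : measurable_fun D (step a h).
Proof. by apply: measurable_funTS; apply: continuous_measurable_fun; exact: step_continuous. Qed.

Lemma sqint_hat a h : sqint (@hat R a h).
Proof. by apply: sqint_continuous; exact: hat_continuous. Qed.

Lemma hat_mass a h : 0 < h -> 0 < a - h -> a + h < 1 ->
  \int[mu]_(t in I01) hat a h t = 1.
Proof.
move=> h0 ah ah1.
rewrite (Rintegral_I01_FTC (@hat_continuous R a h) (is_derive_step a h)).
by rewrite step_right ?step_left ?subr0//; lra.
Qed.

(** The hat has mass [1], is supported in [ball a h] and is at most [h^-1], which is
    twice the density of the uniform probability on that ball. *)
Lemma hat_davg f a h : sqint f -> 0 < h -> 0 < a - h -> a + h < 1 ->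
  ((`|\int[mu]_(t in I01) (f t * hat a h t) - f a|)%:E <=
    2%:E * davg (f \_ I01) a h)%E.
Proof.
move=> Lf h0 ah ah1.
have Lb := sqint_hat a h.
have aI : I01 a by rewrite /I01 /= in_itv /=; lra.
have Lfa : sqint (fun t => f t - f a) := sqint_add Lf (sqint_cst (- f a)).
have ballI : ball a h `<=` (I01 : set R).
  by move=> t; rewrite /ball /= /ball_ ltr_norml /I01 /= in_itv /= => /andP[? ?]; lra.
have -> : \int[mu]_(t in I01) (f t * hat a h t) - f a =
    \int[mu]_(t in I01) ((f t - f a) * hat a h t).
  rewrite -[X in _ - X]mulr1 -(hat_mass h0 ah ah1) -RintegralZl//; last first.
    exact: sqint_integrable.
  rewrite -RintegralB//; [|exact: sqint_mul|].
    by apply: eq_Rintegral => t _; rewrite mulrBl.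
  exact: eq_integrable (integrableZl _ (f a) (sqint_integrable Lb)).
rewrite EFin_normr_Rintegral//; last exact: sqint_mul.
have mF : measurable_fun I01 (fun t => ((f t - f a) * hat a h t)%:E).
  by have /integrableP[] := sqint_mul Lfa Lb.
apply: (le_trans (le_abse_integral _ _ _)) => //.
have -> : (2%:E * davg (f \_ I01) a h =
    \int[mu]_(t in I01) (((fun t => h^-1%:E * `|(f t - f a)%:E|) \_ (ball a h)) t))%E.
  rewrite -integral_mkcondr (setIidr ballI) ge0_integralZl//; last 3 first.
  - exact: measurable_ball.
  - apply: measurable_funS (measurable_I01) ballI _; apply: measurableT_comp => //.
    by apply/measurable_EFinP; case: Lfa.
  - by rewrite lee_fin invr_ge0 ltW.
  rewrite /davg /iavg lebesgue_measure_ball ?ltW// inver gt_eqF ?mulrn_wgt0//.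
  rewrite muleA -EFinM; congr (_%:E * _)%E.
    by field; rewrite gt_eqF.
  apply: eq_integral => t /set_mem /ballI tI.
  by rewrite /= !patchE !mem_set.
apply: ge0_le_integral => //.
- exact: measurableT_comp.
- apply/measurable_restrict => //; first exact: measurable_ball.
  rewrite (setIidr ballI); apply: measurable_funS (measurable_I01) ballI _.
  apply: emeasurable_funM => //; apply: measurableT_comp => //.
  by apply/measurable_EFinP; case: Lfa.
- move=> t _; rewrite patchE; case: ifPn => [tb|].
    rewrite /= -EFinM lee_fin normrM mulrC ler_wpM2r//.
    by rewrite ger0_norm ?hat_ge0// hat_le.
  rewrite notin_setE /ball /= /ball_ => /negP; rewrite -leNgt => tb.
  by rewrite hat_out ?mulr0 ?normr0// distrC.
Qed.

Lemma cvg_hat f a : sqint f -> I01 a -> lebesgue_pt (f \_ I01) a ->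
  \int[mu]_(t in I01) (f t * hat a h t) @[h --> 0^'+] --> f a.
Proof.
move=> Lf; rewrite /I01 /= in_itv /= => /andP[a0 a1] /fine_cvgP[fin cv].
apply/cvgrPdist_le => e e0.
move/cvgrPdist_le : cv => /(_ (e / 2)); rewrite divr_gt0// => /(_ isT) cv.
near=> h.
have h0 : 0 < h by [].
have ha : 0 < a - h by rewrite subr_gt0; near: h; exact: nbhs_right_lt.
have ha1 : a + h < 1.
  by rewrite -ltrBrDl; near: h; apply: nbhs_right_lt; rewrite subr_gt0.
rewrite distrC -lee_fin; apply: (le_trans (hat_davg Lf h0 ha ha1)).
have /fineK <- : davg (f \_ I01) a h \is a fin_num by near: h.
rewrite -EFinM lee_fin -ler_pdivlMl// mulrC.
have : `|0 - fine (davg (f \_ I01) a h)| <= e / 2 by near: h.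
by rewrite sub0r normrN; apply: le_trans; exact: ler_norm.
Unshelve. all: by end_near. Qed.

Lemma cvg_step g a b : sqint g -> 0 < a -> a < b -> b < 1 ->
  \int[mu]_(t in I01) (g t * (step a h t - step b h t)) @[h --> 0^'+] -->
  \int[mu]_(t in `[a, b]) g t.
Proof.
move=> Lg a0 ab b1.
have abI : `[a, b] `<=` (I01 : set R).
  by move=> t; rewrite /I01 /= !in_itv /= => /andP[? ?]; lra.
apply/cvg_at_rightP => u [u0 ucv].
have Ig := sqint_integrable Lg.
have mg : measurable_fun I01 g by case: Lg.
have [] := @dominated_convergence _ _ R mu I01 measurable_I01
  (fun n t => (g t * (step a (u n) t - step b (u n) t))%:E)
  ((EFin \o g) \_ `[a, b]) (fun t => (`|g t|)%:E).
- move=> n; apply/measurable_EFinP; apply: measurable_funM => //.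
  by apply: measurable_funB; exact: measurable_step.
- apply/measurable_restrict => //; rewrite setIidr//.
  by apply/measurable_EFinP; exact: (measurable_funS measurable_I01 abI mg).
- have : mu.-negligible [set a; b].
    apply: negligibleU; apply/negligibleP => //; exact: lebesgue_measure_set1.
  (* The convergence may fail at the two jumps of the limit only. *)
  apply: negligibleS => t /= /not_implyP[tI]; apply: contra_notP => /not_orP[/eqP ta /eqP tb].
  apply: cvg_near_cst; near=> n.
  have ua : u n < `|t - a|.
    near: n; apply: cvgr_lt ucv _ _; by rewrite normr_gt0 subr_eq0.
  have ub : u n < `|t - b|.
    near: n; apply: cvgr_lt ucv _ _; by rewrite normr_gt0 subr_eq0.
  have un := u0 n; rewrite patchE.
  have [tla|atl|ta'] := ltgtP t a; last by have := ta; rewrite ta' eqxx.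
  + rewrite ltr0_norm ?subr_lt0// in ua.
    rewrite memNset; last by rewrite /= in_itv /=; lra.
    by rewrite !step_left ?subrr ?mulr0//; lra.
  + rewrite gtr0_norm ?subr_gt0// in ua.
    rewrite (step_right (a := a)) //; last by lra.
    have [tlb|btl|tb'] := ltgtP t b; last by have := tb; rewrite tb' eqxx.
    * rewrite ltr0_norm ?subr_lt0// in ub.
      rewrite mem_set; last by rewrite /= in_itv /=; lra.
      by rewrite step_left ?subr0 ?mulr1//; lra.
    * rewrite gtr0_norm ?subr_gt0// in ub.
      rewrite memNset; last by rewrite /= in_itv /=; lra.
      by rewrite step_right ?subrr ?mulr0//; lra.
- exact: integrable_norm Ig.
- apply: aeW => t n _ /=; rewrite lee_fin normrM ler_piMr//.
  rewrite ler_norml.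
  have := @ramp_ge0 R ((t - a) / u n); have := @ramp_ge0 R ((t - b) / u n).
  have := @ramp_le1 R ((t - a) / u n); have := @ramp_le1 R ((t - b) / u n).
  by rewrite /step; lra.
move=> Iab _ cv.
apply: fine_cvg; rewrite fineK; last first.
  apply: integrable_fin_num => //; exact: integrableS Ig.
rewrite [X in _ --> X](_ : _ = \int[mu]_(t in I01) ((EFin \o g) \_ `[a, b]) t)%E//.
by rewrite -integral_mkcondr setIidr.
Unshelve. all: by end_near. Qed.

(** Testing with [step a h - step b h] and letting [h] tend to [0] turns the
    definition of the weak derivative into the fundamental theorem of calculus
    between any two Lebesgue points of [f]. *)
Lemma weak_deriv_increment f g a b : weak_deriv f g ->
  0 < a -> a < b -> b < 1 ->
  lebesgue_pt (f \_ I01) a -> lebesgue_pt (f \_ I01) b ->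
  f b - f a = \int[mu]_(t in `[a, b]) g t.
Proof.
move=> [Lf Lg fg] a0 ab b1 La Lb.
have aI : I01 a by rewrite /I01 /= in_itv /=; lra.
have bI : I01 b by rewrite /I01 /= in_itv /=; lra.
have ca := cvg_hat Lf aI La; have cb := cvg_hat Lf bI Lb.
have cg := cvg_step Lg a0 ab b1.
apply/eqP; rewrite -subr_eq0 -[X in X == _]opprK oppr_eq0; apply/eqP.
have c0 : \int[mu]_(t in I01) (f t * hat a h t) - \int[mu]_(t in I01) (f t * hat b h t) +
    \int[mu]_(t in I01) (g t * (step a h t - step b h t)) @[h --> 0^'+] -->
    f a - f b + \int[mu]_(t in `[a, b]) g t.
  by apply: cvgD cg; exact: cvgB.
suff -> : - (f b - f a - \int[mu]_(t in `[a, b]) g t) =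
    f a - f b + \int[mu]_(t in `[a, b]) g t.
  rewrite -(cvg_lim _ c0)//; apply: cvg_lim => //; apply: cvg_near_cst; near=> h.
  have h0 : 0 < h by [].
  have ha : 0 < a - h by rewrite subr_gt0; near: h; exact: nbhs_right_lt.
  have hb : b + h < 1.
    by rewrite -ltrBrDl; near: h; apply: nbhs_right_lt; rewrite subr_gt0.
  have := fg _ (test_fun_step h0 ab ha hb) => H.
  rewrite /= -[X in _ + X = _]opprK -H.
  rewrite -RintegralB; [|exact: measurable_I01|exact: sqint_mul Lf (sqint_hat _ h)|
    exact: sqint_mul Lf (sqint_hat _ h)].
  apply/eqP; rewrite subr_eq0; apply/eqP; apply: eq_Rintegral => t _.
  by rewrite derive1_step mulrBr.
by ring.
Unshelve. all: by end_near. Qed.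

End WeakDerivative.

(** * Continuous representative and uniqueness of the weak derivative *)

Section Sobolev.
Context {R : realType}.
Notation mu := (@lebesgue_measure R).
Implicit Types (f g v w : R -> R) (a b t : R).

(** The open set where [v] and [w] differ is negligible, hence empty. *)
Lemma ae_eq_continuous v w t : I01 t ->
  {for t, continuous v} -> {for t, continuous w} ->
  ae_eq mu I01 v w -> v t = w t.
Proof.
move=> It vt wt vw; apply/eqP; rewrite -subr_eq0; apply: contraT => vwt.
have cvw : {for t, continuous (fun s => v s - w s)} by exact: cvgB.
have [e /= e0 He] : nbhs t (I01 `&` [set s | v s - w s != 0]).
  apply: filterI; first exact: I01_nbhs.
  exact: cvgr_neq0 cvw vwt.
exfalso; apply: (ball_sub_not_negligible e0 He); apply: negligibleS vw.
by move=> s /= [Is +] /(_ Is) E; rewrite E subrr eqxx.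
Qed.

(** Extending [g] by [0] keeps the integrand meaningful for every [t]. *)
Definition prim g t : R := \int[mu]_(s in `[0, t]) (g \_ I01) s.

Lemma integrable_restrict_I01 g (D : set (measurableTypeR R)) : measurable D -> sqint g ->
  mu.-integrable D (EFin \o g \_ I01).
Proof.
move=> mD Lg; apply: (@integrableS _ _ _ mu setT) => //.
rewrite -restrict_EFin; apply/integrable_restrict => //.
by rewrite setTI; exact: sqint_integrable.
Qed.

Lemma prim_increment g a b : sqint g -> 0 < a -> a < b -> b < 1 ->
  prim g b - prim g a = \int[mu]_(t in `[a, b]) g t.
Proof.
move=> Lg a0 ab b1; rewrite /prim Rintegral_itvB; last 3 first.
- exact: integrable_restrict_I01.
- by rewrite bnd_simp ltW.
- by rewrite bnd_simp ltW.
rewrite Rintegral_itv_obnd_cbnd; last exact: integrable_restrict_I01.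
apply: eq_Rintegral => t /set_mem /=; rewrite in_itv /= => /andP[? ?].
by rewrite patchE mem_set// /I01 /= in_itv /=; lra.
Qed.

Lemma prim_continuous g t : sqint g -> I01 t -> {for t, continuous (prim g)}.
Proof.
move=> Lg; rewrite /I01 /= => t01.
have Ig : mu.-integrable `[0, 1] (EFin \o g \_ I01) by exact: integrable_restrict_I01.
have /continuous_within_itvP := parameterized_integral_continuous ler01 Ig.
by move=> /(_ ltr01)[] /(_ t t01).
Qed.

Lemma prim_le g t : sqint g -> `|prim g t| <= \int[mu]_(s in I01) `|g s|.
Proof.
move=> Lg; have Ig D mD := @integrable_restrict_I01 g D mD Lg.
apply: (le_trans (le_normr_Rintegral _ _)) => //; first exact: Ig.
rewrite [leRHS]Rintegral_mkcond [leLHS]Rintegral_mkcond.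
apply: le_Rintegral => //.
- rewrite -restrict_EFin; apply/integrable_restrict => //.
  by rewrite setTI; apply: integrable_norm; exact: Ig.
- rewrite -restrict_EFin; apply/integrable_restrict => //.
  by rewrite setTI; apply: integrable_norm; exact: sqint_integrable.
by move=> s _; rewrite !patchE; do 2 case: ifPn => _; rewrite ?normr0 ?lexx ?normr_ge0.
Qed.

Lemma ae_lebesgue_pt f : sqint f -> {ae mu, forall t, lebesgue_pt (f \_ I01) t}.
Proof.
move=> Lf; apply: lebesgue_differentiation.
by apply: integrable_locally_restrict; [exact: measurable_I01|exact: sqint_integrable].
Qed.

(** Almost every point is a Lebesgue point of [f]; fixing one of them, [a], the
    increment formula determines [f] at all the others. *)
Lemma weak_deriv_repr f g : weak_deriv f g ->
  exists c, ae_eq mu I01 f (fun t => c + prim g t).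
Proof.
move=> fg; have [Lf Lg _] := fg.
have leb := ae_lebesgue_pt Lf.
have [a [aI La]] : exists a, I01 a /\ lebesgue_pt (f \_ I01) a.
  apply: contrapT => /forallNP H.
  have : mu.-negligible (I01 : set R).
    by apply: negligibleS leb => t It /= Lt; exact: (H t).
  apply: (@ball_sub_not_negligible _ _ (2^-1) (2^-1)) => // t.
  by rewrite /ball /= /ball_ ltr_norml /I01 /= in_itv /= => /andP[? ?]; lra.
exists (f a - prim g a).
apply: aeS leb => t Lt It.
move: (aI) (It); rewrite /I01 /= !in_itv /= => /andP[a0 a1] /andP[t0 t1].
have [ta|at_|<-] := ltgtP t a.
- have := weak_deriv_increment fg t0 ta a1 Lt La.
  by rewrite -prim_increment// => E; lra.
- have := weak_deriv_increment fg a0 at_ t1 La Lt.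
  by rewrite -prim_increment// => E; lra.
- by rewrite subrK.
Qed.

Lemma weak_deriv_linear (k : R) f1 g1 f2 g2 : weak_deriv f1 g1 -> weak_deriv f2 g2 ->
  weak_deriv (fun t => k * f1 t + f2 t) (fun t => k * g1 t + g2 t).
Proof.
move=> [Lf1 Lg1 fg1] [Lf2 Lg2 fg2]; split.
- exact: sqint_add (sqint_scale _ _) _.
- exact: sqint_add (sqint_scale _ _) _.
move=> phi tphi; have [dphi cphi _] := tphi.
have Lphi : sqint phi.
  apply: sqint_continuous => t; apply: differentiable_continuous.
  by apply/derivable1_diffP; exact: dphi.
have Ldphi : sqint (derive1 phi) by exact: sqint_continuous.
have lin (p q r : R -> R) : sqint p -> sqint q -> sqint r ->
    \int[mu]_(t in I01) ((k * p t + q t) * r t) =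
    k * \int[mu]_(t in I01) (p t * r t) + \int[mu]_(t in I01) (q t * r t).
  move=> Lp Lq Lr; rewrite -RintegralZl//; last exact: sqint_mul.
  rewrite -RintegralD//; last 2 first.
  - by have := sqint_mul (sqint_scale k Lp) Lr; apply: eq_integrable => // t _; rewrite /= mulrA.
  - exact: sqint_mul.
  by apply: eq_Rintegral => t _; rewrite mulrDl mulrA.
by rewrite !lin// fg1// fg2// opprD mulrN.
Qed.

(** Every point is a Lebesgue point of the zero function, so that the primitive of
    [g] is constant on the interval; it has derivative [g] almost everywhere by
    Lebesgue's differentiation theorem. *)
Lemma weak_deriv0_ae0 g : weak_deriv (cst 0) g -> ae_eq mu I01 g (cst 0).
Proof.
move=> g0; have [L0 Lg _] := g0.
have leb0 t : lebesgue_pt ((cst 0 : R -> R) \_ I01) t.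
  have -> : (cst 0 : R -> R) \_ I01 = cst 0.
    by apply/funext => s; rewrite patchE; case: ifP.
  apply: (@continuous_lebesgue_pt _ _ _ setT) => //.
    by split; [exact: openT|].
  exact: cst_continuous.
have prim_cst a b : I01 a -> I01 b -> prim g a = prim g b.
  rewrite /I01 /= !in_itv /= => /andP[a0 a1] /andP[b0 b1].
  have [ab|ba|->//] := ltgtP a b.
  - have := weak_deriv_increment g0 a0 ab b1 (leb0 _) (leb0 _).
    by rewrite -prim_increment//= => E; lra.
  - have := weak_deriv_increment g0 b0 ba a1 (leb0 _) (leb0 _).
    by rewrite -prim_increment//= => E; lra.
have Ig y : mu.-integrable [set` Interval (BLeft 0) (BRight y)] (EFin \o g \_ I01).
  exact: integrable_restrict_I01.
have loc : locally_integrable setT (g \_ I01).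
  by apply: integrable_locally_restrict; [exact: measurable_I01|exact: sqint_integrable].
have := FTC1 Ig loc; apply: aeS => t Ht It.
have [|_] := Ht.
  by move: It; rewrite /I01 /= in_itv /= => /andP[t0 _]; rewrite lte_fin.
rewrite patchE mem_set// => <-.
rewrite (_ : derive1 _ t = derive1 (cst (prim g t)) t); last first.
  rewrite !derive1E; apply: near_eq_derive.
  by near=> s; apply: prim_cst => //; near: s; exact: I01_nbhs.
by rewrite derive1_cst.
Unshelve. all: by end_near. Qed.

Lemma weak_deriv_unique f g1 g2 : weak_deriv f g1 -> weak_deriv f g2 ->
  ae_eq mu I01 g1 g2.
Proof.
move=> fg1 fg2; have := weak_deriv_linear (-1) fg2 fg1.
rewrite (_ : (fun t => -1 * f t + f t) = cst 0); last first.
  by apply/funext => t /=; ring.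
move=> /weak_deriv0_ae0; apply: aeS => t H It; have /= := H It; lra.
Qed.

End Sobolev.

(** * Vector valued H1 functions *)

Section VectorSobolev.
Context {R : realType} {d : nat}.
Notation mu := (@lebesgue_measure R).
Notation wd := (@weak_derivative R d).
Notation cr := (@continuous_repr R d).
Implicit Types (u v g : R -> 'rV[R]_d) (t k : R) (i : 'I_d).

Lemma weak_derivP u g : is_weak_derivative u g -> L2 u ->
  forall i, weak_deriv (fun t => u t ord0 i) (fun t => g t ord0 i).
Proof. by move=> [Lg ug] Lu i; split; [exact: Lu|exact: Lg|move=> phi; exact: ug]. Qed.

Lemma weak_derivW u g :
  (forall i, weak_deriv (fun t => u t ord0 i) (fun t => g t ord0 i)) ->
  L2 u /\ is_weak_derivative u g.
Proof.
move=> H; split; first by move=> i; case: (H i).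
by split=> [i|phi i]; case: (H i) => // _ _ /(_ phi).
Qed.

Lemma weak_derivativeP u : H1 u -> is_weak_derivative u (wd u).
Proof. by move=> [_ [g ug]]; apply: (xgetPex (fun=> 0)); exists g. Qed.

Lemma H1_weak_deriv u i : H1 u -> weak_deriv (fun t => u t ord0 i) (fun t => wd u t ord0 i).
Proof. by move=> Hu; apply: weak_derivP; [exact: weak_derivativeP|case: Hu]. Qed.

Lemma weak_derivative_ae u g : L2 u -> is_weak_derivative u g ->
  ae_eq mu I01 (wd u) g.
Proof.
move=> Lu ug; have Hu : H1 u by split=> //; exists g.
have : {ae mu, forall t, forall i, I01 t -> wd u t ord0 i = g t ord0 i}.
  apply: ae_forall => i.
  exact: weak_deriv_unique (H1_weak_deriv i Hu) (weak_derivP ug Lu i).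
by apply: aeS => t E It; apply/rowP => i; exact: E.
Qed.

Lemma is_weak_derivative_linear k u v : H1 u -> H1 v ->
  L2 (k *: u + v) /\ is_weak_derivative (k *: u + v) (fun t => k *: wd u t + wd v t).
Proof.
move=> Hu Hv; apply: weak_derivW => i.
have := weak_deriv_linear k (H1_weak_deriv i Hu) (H1_weak_deriv i Hv).
by congr weak_deriv; apply/funext => t; rewrite !mxE.
Qed.

Lemma H1_linear k u v : H1 u -> H1 v -> H1 (k *: u + v).
Proof.
move=> Hu Hv; have [? ?] := is_weak_derivative_linear k Hu Hv.
by split=> //; eexists; eassumption.
Qed.

Lemma weak_derivative_linear k u v : H1 u -> H1 v ->
  ae_eq mu I01 (wd (k *: u + v)) (fun t => k *: wd u t + wd v t).
Proof.
by move=> Hu Hv; have [? ?] := is_weak_derivative_linear k Hu Hv; exact: weak_derivative_ae.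
Qed.

Lemma is_weak_derivative_cst (y : 'rV[R]_d) :
  L2 (fun=> y) /\ is_weak_derivative (fun=> y) (fun=> 0).
Proof.
apply: weak_derivW => i; split.
- exact: sqint_cst.
- by under eq_fun do rewrite mxE; exact: sqint_cst.
move=> phi [dphi cphi [K [_ KI Kphi]]].
have phi0 t : ~ I01 t -> phi t = 0 by move=> nI; apply: Kphi => /KI.
have d1 t : is_derive t 1 phi (derive1 phi t).
  by apply: DeriveDef; [exact: dphi|rewrite derive1E].
rewrite RintegralZl//; last exact: continuous_integrable_I01.
rewrite (Rintegral_I01_FTC cphi d1) !phi0 ?subrr ?mulr0; first last.
- by rewrite /I01 /= in_itv /= ltxx ?andbF.
- by rewrite /I01 /= in_itv /= ltxx ?andbF.
under eq_Rintegral do rewrite mxE mul0r.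
by rewrite Rintegral_I01_cst oppr0.
Qed.

Lemma H1_cst (y : 'rV[R]_d) : H1 (fun=> y).
Proof. by have [? ?] := is_weak_derivative_cst y; split=> //; eexists; eassumption. Qed.

Lemma weak_derivative_cst (y : 'rV[R]_d) : ae_eq mu I01 (wd (fun=> y)) (fun=> 0).
Proof. by have [? ?] := is_weak_derivative_cst y; exact: weak_derivative_ae. Qed.

Lemma continuous_row u t : (forall i, {for t, continuous (fun s => u s ord0 i)}) ->
  {for t, continuous u}.
Proof.
move=> uc A [P PA sPA].
have : \forall s \near t, forall i, P ord0 i (u s ord0 i).
  apply: (@filter_forall R 'I_d (fun i s => P ord0 i (u s ord0 i)) (nbhs t) _) => i.
  by apply: (uc i); exact: PA.
by apply: filterS => s H; apply: sPA => i j; rewrite ord1.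
Qed.

Lemma continuous_reprP u : H1 u ->
  (forall t, I01 t -> {for t, continuous (cr u)}) /\ ae_eq mu I01 u (cr u).
Proof.
move=> Hu; rewrite /continuous_repr.
apply: (xgetPex (fun=> 0) (P := [set v | (forall t, I01 t -> {for t, continuous v}) /\
   ae_eq mu I01 u v])).
have /choice[c Hc] : forall i, exists c, ae_eq mu I01 (fun t => u t ord0 i)
    (fun t => c + prim (fun t => wd u t ord0 i) t).
  by move=> i; exact: weak_deriv_repr (H1_weak_deriv i Hu).
exists (fun t => \row_i (c i + prim (fun t => wd u t ord0 i) t)); split.
- move=> t It; apply: continuous_row => i.
  have -> : (fun s => (\row_i0 (c i0 + prim (fun t => wd u t ord0 i0) s)) ord0 i) =
     (fun s => c i + prim (fun t => wd u t ord0 i) s).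
    by apply/funext => s; rewrite mxE.
  apply: cvgD; first exact: cvg_cst.
  apply: prim_continuous => //; by case: (H1_weak_deriv i Hu).
- have := ae_forall Hc.
  by apply: aeS => t H It; apply/rowP => i; rewrite mxE; exact: H.
Qed.

Lemma continuous_repr_coord u t i : H1 u -> I01 t ->
  {for t, continuous (fun s => cr u s ord0 i)}.
Proof.
move=> Hu It; have [cu _] := continuous_reprP Hu.
apply: (@continuous_comp _ _ _ (cr u) (fun M : 'rV[R]_d => M ord0 i)); first exact: cu.
exact: coord_continuous.
Qed.

Lemma continuous_repr_prim u i : H1 u -> exists c,
  ae_eq mu I01 (fun t => u t ord0 i) (fun t => c + prim (fun s => wd u s ord0 i) t) /\
  forall t, I01 t -> cr u t ord0 i = c + prim (fun s => wd u s ord0 i) t.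
Proof.
move=> Hu; have [c Hc] := weak_deriv_repr (H1_weak_deriv i Hu).
exists c; split=> // t It.
apply: (@ae_eq_continuous _ (fun t => cr u t ord0 i)
  (fun t => c + prim (fun s => wd u s ord0 i) t)) => //.
- exact: continuous_repr_coord.
- apply: cvgD; first exact: cvg_cst.
  by apply: prim_continuous => //; case: (H1_weak_deriv i Hu).
- have [_ uc] := continuous_reprP Hu.
  have E : ae_eq mu I01 (fun t => cr u t ord0 i) (fun t => u t ord0 i).
    by apply: aeS uc => s + Is => /(_ Is) ->.
  exact: ae_eq_trans E Hc.
Qed.

Lemma continuous_repr_linear k u v t i : H1 u -> H1 v -> I01 t ->
  cr (k *: u + v) t ord0 i = k * cr u t ord0 i + cr v t ord0 i.
Proof.
move=> Hu Hv It; have Huv := H1_linear k Hu Hv.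
apply: (@ae_eq_continuous _ (fun t => cr (k *: u + v) t ord0 i)
  (fun t => k * cr u t ord0 i + cr v t ord0 i)) => //.
- exact: continuous_repr_coord.
- apply: cvgD; last exact: continuous_repr_coord.
  by apply: cvgM; [exact: cvg_cst|exact: continuous_repr_coord].
- have [_ U] := continuous_reprP Hu; have [_ V] := continuous_reprP Hv.
  have [_ UV] := continuous_reprP Huv.
  have := ae_and U (ae_and V UV).
  apply: aeS => s [Us [Vs UVs]] Is.
  by rewrite -UVs// -Us// -Vs// !mxE.
Qed.

End VectorSobolev.

(** * Bounded linear functionals on H1 *)

Section Duals.
Context {R : realType} {d : nat}.
Notation mu := (@lebesgue_measure R).
Notation wd := (@weak_derivative R d).
Notation cr := (@continuous_repr R d).
Implicit Types (u v : R -> 'rV[R]_d) (x : 'rV[R]_d) (t k : R) (i : 'I_d).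

Lemma enorm_ge0 x : 0 <= enorm x. Proof. exact: sqrtr_ge0. Qed.

Lemma enorm_sqr x : enorm x ^+ 2 = \sum_i x ord0 i ^+ 2.
Proof. by rewrite /enorm sqr_sqrtr// sumr_ge0// => i _; exact: sqr_ge0. Qed.

Lemma enorm0 : enorm (0 : 'rV[R]_d) = 0.
Proof. by rewrite /enorm big1 ?sqrtr0// => i _; rewrite mxE expr0n. Qed.

Lemma coord_le_enorm x i : `|x ord0 i| <= enorm x.
Proof.
rewrite -(@ler_pXn2r _ 2)// ?nnegrE ?enorm_ge0// enorm_sqr real_normK ?num_real//.
by rewrite (bigD1 i)//= lerDl sumr_ge0// => j _; exact: sqr_ge0.
Qed.

Lemma L2_enorm_integrable u : L2 u ->
  mu.-integrable I01 (fun t => (enorm (u t) ^+ 2)%:E).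
Proof.
move=> Lu; under eq_fun do rewrite enorm_sqr.
by apply: integrable_finsum => i; case: (Lu i).
Qed.

Lemma Rintegral_enorm u : L2 u -> \int[mu]_(t in I01) (enorm (u t) ^+ 2) =
  \sum_i \int[mu]_(t in I01) (u t ord0 i ^+ 2).
Proof.
move=> Lu; rewrite -Rintegral_finsum; last by move=> i; case: (Lu i).
by apply: eq_Rintegral => t _; rewrite enorm_sqr.
Qed.

Lemma H1_weak_L2 u : H1 u -> L2 (wd u).
Proof. by move=> /weak_derivativeP[]. Qed.

Lemma sqrt_coord_le u i : L2 u ->
  Num.sqrt (\int[mu]_(t in I01) (u t ord0 i ^+ 2)) <=
  Num.sqrt (\int[mu]_(t in I01) (enorm (u t) ^+ 2)).
Proof.
move=> Lu; rewrite ler_wsqrtr// Rintegral_enorm// (bigD1 i)//= lerDl sumr_ge0// => j _.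
by apply: Rintegral_ge0 => t _; exact: sqr_ge0.
Qed.

Lemma sqrt_coord_le_H1norm u i : H1 u ->
  Num.sqrt (\int[mu]_(t in I01) (u t ord0 i ^+ 2)) <= H1norm u.
Proof.
move=> Hu; apply: le_trans (sqrt_coord_le i Hu.1) _.
by rewrite ler_wsqrtr// lerDl; apply: Rintegral_ge0 => t _; exact: sqr_ge0.
Qed.

Lemma sqrt_dcoord_le_H1norm u i : H1 u ->
  Num.sqrt (\int[mu]_(t in I01) (wd u t ord0 i ^+ 2)) <= H1norm u.
Proof.
move=> Hu; apply: le_trans (sqrt_coord_le i (H1_weak_L2 Hu)) _.
by rewrite ler_wsqrtr// lerDr; apply: Rintegral_ge0 => t _; exact: sqr_ge0.
Qed.

Lemma ae_le_Rintegral (f g : R -> R) : sqint f -> sqint g ->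
  {ae mu, forall t, I01 t -> f t <= g t} ->
  \int[mu]_(t in I01) f t <= \int[mu]_(t in I01) g t.
Proof.
move=> Lf Lg fg; apply: fine_le.
- by apply: integrable_fin_num => //; exact: sqint_integrable.
- by apply: integrable_fin_num => //; exact: sqint_integrable.
- apply: ae_le_integral; [by apply/measurable_EFinP; case: Lf|
    by apply/measurable_EFinP; case: Lg|].
  by apply: aeS fg => t + It => /(_ It); rewrite lee_fin.
Qed.

(** Sobolev embedding: writing [cr u] as [c + prim u'], both [c] and [prim u'] are
    controlled by integrals of [|u|] and [|u'|], for [c] by averaging
    [c = u - prim u'] over the interval. *)
Lemma continuous_repr_bound u t i : H1 u -> I01 t -> `|cr u t ord0 i| <= 3 * H1norm u.
Proof.
move=> Hu It; have [c [uc ->//]] := continuous_repr_prim i Hu.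
have [Lu Lg _] := H1_weak_deriv i Hu.
set g := fun s => wd u s ord0 i in uc Lg *.
have := sqrt_coord_le_H1norm i Hu; have := sqrt_dcoord_le_H1norm i Hu.
have := Rintegral_norm_le_sqrt Lg; have := Rintegral_norm_le_sqrt Lu.
set A := \int[mu]_(s in I01) `|u s ord0 i|; set B := \int[mu]_(s in I01) `|g s|.
move=> hA hB hB' hA'.
have cAB : `|c| <= A + B.
  have : \int[mu]_(s in I01) (cst `|c| s) <= \int[mu]_(s in I01) (`|u s ord0 i| + cst B s).
    apply: ae_le_Rintegral; [exact: sqint_cst|exact: sqint_add (sqint_norm Lu) (sqint_cst _)|].
    apply: aeS uc => s + Is => /(_ Is) ->.
    have := prim_le s Lg; rewrite -/B /= => h.
    have := ler_normB (c + prim g s) (prim g s); rewrite addrK => h'.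
    by rewrite (le_trans h')// lerD2l.
  rewrite RintegralD//; last 2 first.
  - exact: sqint_integrable (sqint_norm Lu).
  - exact: sqint_integrable (sqint_cst B).
  by rewrite !Rintegral_I01_cst.
apply: (le_trans (ler_normD _ _)).
have := prim_le t Lg; rewrite -/B; lra.
Qed.

(** Weak convergence tested on these functionals is pointwise convergence of the
    continuous representatives. *)
Lemma H1_dual_eval t i : I01 t -> H1_dual (fun u => cr u t ord0 i).
Proof.
move=> It; split=> [k u v Hu Hv|]; first exact: continuous_repr_linear.
by exists 3 => u Hu; exact: continuous_repr_bound.
Qed.

(** Weak convergence tested on these functionals is weak convergence in [L2] of the
    derivatives. *)
Lemma H1_dual_pairing (p : R -> R) i : sqint p ->
  H1_dual (fun u => \int[mu]_(t in I01) (p t * wd u t ord0 i)).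
Proof.
move=> Lp; have Lwd u (Hu : H1 u) : sqint (fun t => wd u t ord0 i).
  by case: (H1_weak_deriv i Hu).
split=> [k u v Hu Hv|].
  have Iu := sqint_mul Lp (Lwd _ Hu); have Iv := sqint_mul Lp (Lwd _ Hv).
  have Luv := Lwd _ (H1_linear k Hu Hv).
  rewrite -RintegralZl// -RintegralD//; last first.
    exact: eq_integrable (integrableZl _ k Iu).
  apply: ae_eq_Rintegral.
  - by apply: measurable_funM; [case: Lp|case: Luv].
  - apply: measurable_funD; last by apply/measurable_EFinP; exact: measurable_int Iv.
    by apply: measurable_funM => //; apply/measurable_EFinP; exact: measurable_int Iu.
  - apply: aeS (weak_derivative_linear k Hu Hv) => t + It => /(_ It) ->.
    by rewrite !mxE; ring.
exists (Num.sqrt (\int[mu]_(t in I01) (p t ^+ 2))) => u Hu.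
apply: (le_trans (Cauchy_Schwarz Lp (Lwd _ Hu))).
by rewrite ler_wpM2l ?sqrtr_ge0// sqrt_dcoord_le_H1norm.
Qed.

Lemma H1norm_cst (y : 'rV[R]_d) : H1norm (fun=> y) = enorm y.
Proof.
rewrite /H1norm Rintegral_I01_cst.
rewrite (_ : \int[mu]_(t in I01) (enorm (wd (fun=> y) t) ^+ 2) = 0).
  by rewrite addr0 sqrtr_sqr ger0_norm ?enorm_ge0.
rewrite -[RHS](Rintegral_I01_cst 0).
apply: ae_eq_Rintegral => //.
  by have /integrableP[/measurable_EFinP] := L2_enorm_integrable (H1_weak_L2 (H1_cst y)).
apply: aeS (weak_derivative_cst y) => t + It => /(_ It) ->.
by rewrite enorm_sqr big1// => i _; rewrite mxE expr0n.
Qed.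

End Duals.

(** * Borel functions of measurable vectors *)

Section BorelComposition.
Context {R : realType} {d : nat} {disp : measure_display} {T : measurableType disp}.

(** An open set is the countable union of the boxes with rational corners that it
    contains, and the preimage of a box is given by conditions on coordinates. *)
Lemma measurable_preimage_open (D : set T) (v : T -> 'rV[R]_d) (A : set 'rV[R]_d) :
  measurable D -> (forall i, measurable_fun D (fun t => v t ord0 i)) ->
  open A -> measurable (D `&` v @^-1` A).
Proof.
move=> mD mv oA.
pose box (q : {ffun 'I_d -> rat * rat}) : set 'rV[R]_d :=
  [set x | forall i, x ord0 i \in `](ratr (q i).1 : R), ratr (q i).2[].
have mbox q : measurable (D `&` v @^-1` box q).
  have -> : D `&` v @^-1` box q =
     D `&` \bigcap_(i in [set: 'I_d]) (D `&` (fun t => v t ord0 i) @^-1`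
       `](ratr (q i).1 : R), ratr (q i).2[%classic).
    apply/seteqP; split=> t /=.
    - by move=> [Dt H]; split=> // i _; split=> //; exact: H.
    - by move=> [Dt H]; split=> // i; have [] := H i I.
  apply: measurableI => //; apply: fin_bigcap_measurable => // i _.
  by apply: mv => //; exact: measurable_itv.
have -> : D `&` v @^-1` A = \bigcup_(q in [set: {ffun 'I_d -> rat * rat}])
    (if `[< box q `<=` A >] then D `&` v @^-1` box q else set0).
  apply/seteqP; split=> t /=; last first.
    by move=> [q _]; case: asboolP => // qA [Dt /qA].
  move=> [Dt Avt].
  have := oA; rewrite openE => /(_ _ Avt) /nbhs_ballP[e /= e0 eA].
  have /choice[q Hq] i : exists q : rat * rat,
      (ratr q.1 \in `](v t ord0 i - e), (v t ord0 i)[) /\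
      (ratr q.2 \in `](v t ord0 i), (v t ord0 i + e)[).
    have [|a Ha] := @rat_in_itvoo R (v t ord0 i - e) (v t ord0 i); first by rewrite ltrBlDr ltrDl.
    have [|b Hb] := @rat_in_itvoo R (v t ord0 i) (v t ord0 i + e); first by rewrite ltrDl.
    by exists (a, b).
  exists [ffun i => q i] => //.
  rewrite asboolT.
    by split=> // i; have [] := Hq i; rewrite ffunE !in_itv /= => /andP[_ ->] /andP[-> _].
  move=> x Hx; apply: eA; split=> // j i; rewrite ord1.
  have [] := Hq i; have := Hx i; rewrite ffunE !in_itv /= => /andP[x1 x2] /andP[a1 a2] /andP[b1 b2].
  by rewrite /ball /= ltr_norml; lra.
apply: countable_bigcupT_measurable; first exact: countableP.
by move=> q; case: asboolP.
Qed.

(** The sets whose preimage is measurable form a sigma-algebra. *)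
Lemma measurable_borel_comp (W : 'rV[R]_d -> R) (D : set T) (v : T -> 'rV[R]_d) :
  borel_fun W -> measurable D -> (forall i, measurable_fun D (fun t => v t ord0 i)) ->
  measurable_fun D (W \o v).
Proof.
move=> BW mD mv _ B mB.
pose C : set (set 'rV[R]_d) := [set A | measurable (D `&` v @^-1` A)].
suff H : <<s @open 'rV[R]_d >> `<=` C by exact: H (BW B mB).
apply: smallest_sub; last by move=> A oA; exact: measurable_preimage_open.
split.
- by rewrite /C /= preimage_set0 setI0.
- move=> A CA; rewrite /C /= setTD.
  have -> : D `&` v @^-1` (~` A) = D `\` (D `&` v @^-1` A).
    by rewrite setDIr setDv set0U setDE preimage_setC.
  exact: measurableD.
- move=> A CA; rewrite /C /= preimage_bigcup setI_bigcupr.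
  by apply: bigcup_measurable => n _; exact: CA.
Qed.

End BorelComposition.

(** * Comparison with converging families *)

Section LimInfSup.
Context {R : realType}.
Local Open Scope ereal_scope.
Implicit Types (F : R -> \bar R).

Lemma limf_einf_ge F (A : R -> R) (l : R) : A x @[x --> 0%R^'+] --> l ->
  (\forall x \near 0%R^'+, (A x)%:E <= F x) -> l%:E <= limf_einf F 0%R^'+.
Proof.
move=> Al AF; apply/lee_addgt0Pr => e e0.
rewrite -leeBlDr// limf_einfE.
pose V := [set x | (l - e)%:E <= F x].
have nV : (0%R : R)^'+ V.
  have lA : \forall x \near (0%R : R)^'+, (l - e < A x)%R.
    by apply: (cvgr_gt l Al); rewrite ltrBlDr ltrDl.
  near=> x; rewrite /V /=; apply: (@le_trans _ _ (A x)%:E); last by near: x.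
  by rewrite lee_fin ltW//; near: x.
apply: (@le_trans _ _ (ereal_inf (F @` V))).
  by apply: le_ereal_inf_tmp => _ [x Vx <-].
by apply: ereal_sup_ubound; exists V.
Unshelve. all: by end_near. Qed.

Lemma limf_esup_le F (A : R -> R) (l : R) : A x @[x --> 0%R^'+] --> l ->
  (\forall x \near 0%R^'+, F x <= (A x)%:E) -> limf_esup F 0%R^'+ <= l%:E.
Proof.
move=> Al AF; rewrite -leeN2 -limf_einfN -EFinN.
apply: (@limf_einf_ge _ (fun x => - A x)%R); first exact: cvgN.
by apply: filterS AF => x; rewrite EFinN leeN2.
Qed.

End LimInfSup.

(** * The integrand and the zero set *)

Section Integrands.
Context {R : realType} {d : nat}.
Notation mu := (@lebesgue_measure R).
Notation wd := (@weak_derivative R d).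
Notation cr := (@continuous_repr R d).
Implicit Types (u v : R -> 'rV[R]_d) (x : 'rV[R]_d) (t k : R) (i : 'I_d).

Lemma measurable_repr_coord u i : H1 u -> measurable_fun I01 (fun t => cr u t ord0 i).
Proof.
move=> Hu; apply: open_continuous_measurable_fun; first exact: interval_open.
by move=> t /set_mem It; exact: continuous_repr_coord.
Qed.

Lemma measurable_zero_set u : H1 u -> measurable (zero_set u : set (measurableTypeR R)).
Proof.
move=> Hu.
have -> : zero_set u = I01 `&` \bigcap_(i in [set: 'I_d])
    (I01 `&` (fun t => cr u t ord0 i) @^-1` [set 0]).
  apply/seteqP; split=> t /= [It H]; split=> //.
  - by move=> i _; split=> //=; rewrite H mxE.
  - by apply/rowP => i; have [_ /= ->] := H i I; rewrite mxE.
apply: measurableI => //; apply: fin_bigcap_measurable => // i _.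
have mi := measurable_repr_coord i Hu.
exact: (mi measurable_I01 [set 0] (measurable_set1 0)).
Qed.

Lemma zero_set_sub u : zero_set u `<=` I01.
Proof. by move=> t []. Qed.

Lemma measure_zero_set_fin u : H1 u -> mu (zero_set u) \is a fin_num.
Proof.
move=> Hu; rewrite ge0_fin_numE ?measure_ge0//.
apply: (@le_lt_trans _ _ (mu I01)); last by rewrite mu_I01 ltry.
apply: le_measure; rewrite ?inE//; [exact: measurable_zero_set|exact: zero_set_sub].
Qed.

Lemma measurable_wd_sqr u : H1 u -> measurable_fun I01 (fun t => enorm (wd u t) ^+ 2).
Proof.
by move=> Hu; have /integrableP[/measurable_EFinP] := L2_enorm_integrable (H1_weak_L2 Hu).
Qed.

Lemma measurable_W_scale (W : 'rV[R]_d -> R) k u : borel_fun W ->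
  (forall i, measurable_fun I01 (fun t => u t ord0 i)) ->
  measurable_fun I01 (fun t => W (k *: u t)).
Proof.
move=> BW mu_; apply: (measurable_borel_comp (v := fun t => k *: u t) BW measurable_I01) => i.
by under eq_fun do rewrite mxE; apply: measurable_funM.
Qed.

Lemma measurable_Geps_integrand (W : 'rV[R]_d -> R) k u : borel_fun W -> H1 u ->
  measurable_fun I01 (fun t => (enorm (wd u t) ^+ 2 + W (k *: u t))%:E).
Proof.
move=> BW Hu; apply/measurable_EFinP; apply: measurable_funD.
  exact: measurable_wd_sqr.
by apply: measurable_W_scale => // i; case: (Hu.1 i).
Qed.

Lemma integrable_zero_set_cst u (c : R) : H1 u ->
  mu.-integrable I01 (fun t => (c * \1_(zero_set u) t)%:E).
Proof.
move=> Hu; have : sqint (\1_(zero_set u) : R -> R).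
  apply: (@sqint_bounded _ _ 1).
    by apply: measurable_indic; exact: measurable_zero_set.
  by move=> t _; rewrite indicE; case: (_ \in _); rewrite ?normr1// normr0.
by move/(sqint_scale c)/sqint_integrable.
Qed.

Lemma Rintegral_zero_set_cst u (c : R) : H1 u ->
  \int[mu]_(t in I01) (c * \1_(zero_set u) t) = c * fine (mu (zero_set u)).
Proof.
move=> Hu; rewrite RintegralZl//; last first.
  by have := integrable_zero_set_cst 1 Hu; apply: eq_integrable => // t _; rewrite mul1r.
congr (_ * _); rewrite /Rintegral integral_indic//; last exact: measurable_zero_set.
by rewrite setIidl//; exact: zero_set_sub.
Qed.

End Integrands.

(** * Upper bound *)

Section LimSup.
Context {R : realType} {d : nat}.
Notation mu := (@lebesgue_measure R).
Notation wd := (@weak_derivative R d).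
Notation cr := (@continuous_repr R d).
Variables (W : 'rV[R]_d -> R).

(** The ball of radius [1 / sqrt eps] grows to the whole space, yet [eps y_eps] tends
    to [0]. As [W] may be unbounded below on a ball, [- eps^-1] is accepted in place of
    the infimum when [W] goes below it. *)
Lemma near_minimizers : exists y : R -> 'rV[R]_d,
  (forall eps, 0 < eps -> enorm (y eps) ^+ 2 * eps <= 1) /\
  (forall x, \forall eps \near 0^'+, W (y eps) <= W x + eps).
Proof.
have /choice[y Hy] : forall eps : R, exists z : 'rV[R]_d, 0 < eps ->
    enorm z ^+ 2 * eps <= 1 /\
    forall x, enorm x ^+ 2 * eps <= 1 -> - eps^-1 <= W x -> W z <= W x + eps.
  move=> eps; have [e0|?] := boolP (0 < eps); last by exists 0.
  pose S := [set z : 'rV[R]_d | enorm z ^+ 2 * eps <= 1].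
  have [[z [Sz Wz]]|/forallNP H] := pselect (exists z, S z /\ W z <= - eps^-1).
    exists z => _; split=> // x _ Wx; apply: (le_trans Wz); apply: (le_trans Wx).
    by rewrite lerDl ltW.
  have hinf : has_inf (W @` S).
    split; first by exists (W 0); exists 0 => //; rewrite /S /= enorm0 expr0n mul0r.
    by exists (- eps^-1) => _ [z Sz <-]; rewrite leNgt; apply/negP => /ltW Wz; apply: (H z).
  have [_ [z Sz <-] Wz] := inf_adherent e0 hinf.
  exists z => _; split=> // x Sx _; apply: (le_trans (ltW Wz)).
  by rewrite lerD2r; apply: ge_inf; [case: hinf|exists x].
exists y; split; first by move=> eps /Hy[].
move=> x; near=> eps.
have e0 : 0 < eps by [].
apply: (Hy eps e0).2.
- have : eps <= (enorm x ^+ 2 + 1)^-1.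
    by near: eps; apply: nbhs_right_le; rewrite invr_gt0 ltr_wpDl ?sqr_ge0.
  have e1 : 0 < enorm x ^+ 2 + 1 by rewrite ltr_wpDl ?sqr_ge0.
  rewrite -[leRHS]mul1r ler_pdivlMr// mulrDr mulr1 mulrC; apply: le_trans.
  by rewrite lerDl ltW.
- have : eps <= (`|W x| + 1)^-1.
    by near: eps; apply: nbhs_right_le; rewrite invr_gt0 ltr_wpDl.
  have e1 : 0 < `|W x| + 1 by rewrite ltr_wpDl.
  rewrite -lef_pV2 ?posrE ?invr_gt0// invrK => H.
  rewrite lerNl; apply: le_trans H; rewrite -normrN.
  by apply: (le_trans (ler_norm _)); rewrite lerDl.
Unshelve. all: by end_near. Qed.

(** The bound is stated for each value [W x], so that it also covers the case
    where the infimum of [W] is [-oo]. *)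
Lemma limsup_inequality (u : R -> 'rV[R]_d) : borel_fun W -> (forall x, W x <= 0) ->
  H1 u -> exists ueps : R -> R -> 'rV[R]_d,
    [/\ forall eps, 0 < eps -> H1 (ueps eps), H1_weak_cvg ueps u &
      forall x, (limf_esup (fun eps => Geps W eps (ueps eps)) 0^'+ <=
        (\int[mu]_(t in I01) (enorm (wd u t) ^+ 2) +
         W x * fine (mu (zero_set u)))%:E)%E].
Proof.
move=> BW W0 Hu; have [y [ybnd ymin]] := near_minimizers.
pose ueps eps := eps *: (fun _ : R => y eps) + u.
have Hue eps : H1 (ueps eps) by apply: H1_linear => //; exact: H1_cst.
exists ueps; split=> // [L [Llin [C LC]]|x].
  have sq0 : Num.sqrt eps * `|C| @[eps --> (0 : R)^'+] --> (0 : R).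
    rewrite -[X in _ --> X](mul0r `|C|) -[X in X * _]sqrtr0.
    apply: cvgM; last exact: cvg_cst.
    by apply: cvg_at_right_filter; exact: sqrt_continuous.
  apply/cvgrPdist_le => e e0; move/cvgrPdist_le : sq0 => /(_ e e0) sq0.
  near=> eps; have eps0 : 0 < eps by [].
  rewrite Llin//; last exact: H1_cst.
  rewrite opprD addrCA subrr addr0 normrN normrM (gtr0_norm eps0).
  have Ly : `|L (fun=> y eps)| <= `|C| * enorm (y eps).
    apply: (le_trans (LC _ (H1_cst (y eps)))); rewrite H1norm_cst.
    by rewrite ler_wpM2r ?enorm_ge0// ler_norm.
  have : `|0 - Num.sqrt eps * `|C| | <= e by near: eps.
  rewrite sub0r normrN (@ger0_norm _ (Num.sqrt eps * `|C|)) ?mulr_ge0 ?sqrtr_ge0//.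
  apply: le_trans; apply: (@le_trans _ _ (eps * (`|C| * enorm (y eps)))).
    by apply: ler_wpM2l => //; exact: ltW.
  rewrite mulrCA mulrC ler_wpM2r//.
  rewrite -(@ler_pXn2r _ 2)// ?nnegrE ?sqrtr_ge0 ?mulr_ge0 ?enorm_ge0 ?(ltW eps0)//.
  have -> : (eps * enorm (y eps)) ^+ 2 = eps * (enorm (y eps) ^+ 2 * eps) by ring.
  rewrite (sqr_sqrtr (ltW eps0)).
  by rewrite -[leRHS]mulr1; apply: ler_wpM2l; [exact: ltW|exact: ybnd].
have Iu := L2_enorm_integrable (H1_weak_L2 Hu).
apply: (@limf_esup_le _ _ (fun eps => \int[mu]_(t in I01) (enorm (wd u t) ^+ 2) +
   (W x + eps) * fine (mu (zero_set u)))).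
  apply: cvgD; first exact: cvg_cst.
  apply: cvgM; last exact: cvg_cst.
  rewrite -[X in _ --> X]addr0; apply: cvgD; first exact: cvg_cst.
  by apply: cvg_at_right_filter; exact: cvg_id.
near=> eps; have eps0 : 0 < eps by [].
have Wy : W (y eps) <= W x + eps by near: eps; exact: ymin.
have IZ := integrable_zero_set_cst (W (y eps)) Hu.
apply: (@le_trans _ _ (\int[mu]_(t in I01)
    (enorm (wd u t) ^+ 2 + W (y eps) * \1_(zero_set u) t)%:E)%E).
  apply: ae_le_integral.
  - exact: measurable_Geps_integrand.
  - apply/measurable_EFinP; apply: measurable_funD; first exact: measurable_wd_sqr.
    by have /integrableP[/measurable_EFinP] := IZ.
  (* Almost everywhere [u] equals its continuous representative, so that
     [eps^-1 *: ueps eps t] equals [y eps] on the zero set. *)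
  have [_ uc] := continuous_reprP Hu.
  have wl := weak_derivative_linear eps (H1_cst (y eps)) Hu.
  have := ae_and uc (ae_and wl (weak_derivative_cst (y eps))).
  apply: aeS => t [ut [wt w0]] It; rewrite lee_fin /ueps wt// w0// scaler0 add0r lerD2l.
  rewrite indicE; have [tZ|tZ] := boolP (t \in zero_set u); last by rewrite mulr0.
  rewrite mulr1 !fctE /= ut//.
  have [_ ->] := set_mem tZ.
  by rewrite addr0 scalerA mulVf ?gt_eqF// scale1r.
rewrite (_ : integral _ _ _ = (\int[mu]_(t in I01)
    (enorm (wd u t) ^+ 2 + W (y eps) * \1_(zero_set u) t))%:E).
  rewrite lee_fin RintegralD// lerD2l Rintegral_zero_set_cst//.
  by rewrite ler_wpM2r// fine_ge0// measure_ge0.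
rewrite /Rintegral fineK//; apply: integrable_fin_num => //.
exact: eq_integrable (integrableD measurable_I01 Iu IZ).
Unshelve. all: by end_near. Qed.

End LimSup.

(** * Lower bound *)

Section LimInf.
Context {R : realType} {d : nat}.
Notation mu := (@lebesgue_measure R).
Notation wd := (@weak_derivative R d).
Notation cr := (@continuous_repr R d).
Variables (W : 'rV[R]_d -> R) (m : R).
Hypotheses (BW : borel_fun W) (W0 : forall x, W x <= 0) (Wm : forall x, m <= W x)
  (Winf : vanishes_at_infinity W).
Variables (u : R -> 'rV[R]_d) (ueps : R -> R -> 'rV[R]_d).
Hypotheses (Hu : H1 u) (Hue : forall eps, 0 < eps -> H1 (ueps eps))
  (ucvg : H1_weak_cvg ueps u).

Let offzero (eps t : R) : R :=
  W (eps^-1 *: cr (ueps eps) t) * (1 - \1_(zero_set u) t).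

Let W_bound x : `|W x| <= `|m|.
Proof. by rewrite ler0_norm ?W0// ler0_norm ?lerN2 ?Wm// (le_trans (Wm x)). Qed.

Let measurable_ind : measurable_fun I01 (fun t => 1 - \1_(zero_set u) t : R).
Proof.
apply: measurable_funB => //; apply: measurable_indic.
exact: measurable_zero_set.
Qed.

Let sqint_offzero eps : 0 < eps -> sqint (offzero eps).
Proof.
move=> e0; apply: (@sqint_bounded _ _ `|m|).
  apply: measurable_funM; last exact: measurable_ind.
  by apply: measurable_W_scale => // i; apply: measurable_repr_coord; exact: Hue.
move=> t _; rewrite /offzero indicE; case: (_ \in _) => /=.
  by rewrite subrr mulr0 normr0.
by rewrite subr0 mulr1 W_bound.
Qed.

(** Off the zero set of [u] the rescaled functions escape to infinity, where [W]
    vanishes. *)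
Let offzero_cvg t : I01 t -> offzero eps t @[eps --> 0^'+] --> (0 : R).
Proof.
move=> It; rewrite /offzero indicE; have [tZ|tZ] := boolP (t \in zero_set u).
  under eq_fun do rewrite subrr mulr0.
  exact: cvg_cst.
under eq_fun do rewrite subr0 mulr1.
have [i ui] : exists i, cr u t ord0 i != 0.
  apply: contrapT => /forallNP H; move/negP: tZ; apply; apply/mem_set; split=> //.
  by apply/rowP => i; rewrite mxE; apply/eqP; have /negP := H i; rewrite negbK.
have ci := ucvg (H1_dual_eval i It).
apply/cvgrPdist_lt => e e0; have [M HM] := Winf e0.
pose c := `|cr u t ord0 i|.
have c0 : 0 < c by rewrite normr_gt0.
have c2 : \forall eps \near 0^'+, c / 2 < `|cr (ueps eps) t ord0 i|.
  apply: (@cvgr_gt _ _ _ _ (fun eps => `|cr (ueps eps) t ord0 i|) c).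
    exact: cvg_norm.
  by rewrite ltr_pdivrMr// ltr_pMr// ltr1n.
near=> eps; have eps0 : 0 < eps by [].
rewrite sub0r normrN; apply: HM.
apply: lt_le_trans (coord_le_enorm _ i).
rewrite mxE normrM normfV (gtr0_norm eps0) ltr_pdivlMl//.
apply: (@le_lt_trans _ _ (c / 2)); last by near: eps.
have : eps <= c / 2 / (`|M| + 1).
  by near: eps; apply: nbhs_right_le; rewrite !divr_gt0// ltr_wpDl.
rewrite ler_pdivlMr ?ltr_wpDl//; apply: le_trans.
apply: ler_wpM2l; first exact: ltW.
by apply: (le_trans (ler_norm M)); rewrite lerDl.
Unshelve. all: by end_near. Qed.

Let integral_offzero_cvg :
  \int[mu]_(t in I01) offzero eps t @[eps --> 0^'+] --> (0 : R).
Proof.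
apply/cvg_at_rightP => e [e0 ecv].
have [] := @dominated_convergence _ _ R mu I01 measurable_I01
  (fun n t => (offzero (e n) t)%:E) (fun=> 0%E) (fun=> `|m|%:E).
- by move=> n; apply/measurable_EFinP; case: (sqint_offzero (e0 n)).
- exact: measurable_cst.
- apply: aeW => t It; apply: cvg_EFin; first exact: nearW.
  by move/cvg_at_rightP : (offzero_cvg It); apply.
- exact: sqint_integrable (sqint_cst `|m|).
- apply: aeW => t n _ /=; rewrite lee_fin /offzero indicE; case: (_ \in _) => /=.
    by rewrite subrr mulr0 normr0.
  by rewrite subr0 mulr1 W_bound.
move=> _ _; rewrite integral0 => cv.
exact: (fine_cvg cv).
Qed.

(** The derivative terms are handled by [|a| ^ 2 >= 2 a b - |b| ^ 2] with [b]
    the weak derivative of [u], which is linear in the varying function and so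
    passes to the weak limit. *)
Lemma liminf_inequality :
  ((\int[mu]_(t in I01) (enorm (wd u t) ^+ 2) + m * fine (mu (zero_set u)))%:E <=
   limf_einf (fun eps => Geps W eps (ueps eps)) 0^'+)%E.
Proof.
have Lwd (v : R -> 'rV[R]_d) i : H1 v -> sqint (fun t => wd v t ord0 i).
  by move=> Hv; case: (H1_weak_deriv i Hv).
pose P (v : R -> 'rV[R]_d) i := \int[mu]_(t in I01) (wd u t ord0 i * wd v t ord0 i).
pose A eps := \sum_i (2 * P (ueps eps) i - P u i) + \int[mu]_(t in I01) offzero eps t
   + m * fine (mu (zero_set u)).
apply: (@limf_einf_ge _ _ A).
  apply: cvgD; last exact: cvg_cst.
  rewrite -[X in _ --> X]addr0; apply: cvgD; last exact: integral_offzero_cvg.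
  rewrite Rintegral_enorm; last exact: H1_weak_L2.
  have -> : \sum_i \int[mu]_(t in I01) (wd u t ord0 i ^+ 2) = \sum_i (2 * P u i - P u i).
    by apply: eq_bigr => i _; rewrite mulr_natl mulr2n addrK.
  apply: cvg_big => [|i _]; first exact: add_continuous.
  apply: cvgB; last exact: cvg_cst.
  apply: cvgM; first exact: cvg_cst.
  exact: (ucvg (H1_dual_pairing i (Lwd u i Hu))).
near=> eps; have eps0 : 0 < eps by [].
have Hv := Hue eps0; set v := ueps eps in Hv *.
pose q i t := 2 * (wd u t ord0 i * wd v t ord0 i) - wd u t ord0 i ^+ 2.
have Iq i : mu.-integrable I01 (EFin \o q i).
  have I1 := sqint_mul (Lwd u i Hu) (Lwd v i Hv).
  have [_ I2] := Lwd u i Hu.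
  exact: eq_integrable (integrableB measurable_I01 (integrableZl measurable_I01 2 I1) I2).
have Isum : mu.-integrable I01 (fun t => (\sum_i q i t)%:E).
  exact: integrable_finsum.
have Ioff := sqint_integrable (sqint_offzero eps0).
have IZ := integrable_zero_set_cst m Hu.
have I12 := integrableD measurable_I01 Isum Ioff.
have Iall := integrableD measurable_I01 I12 IZ.
have -> : (A eps)%:E = (\int[mu]_(t in I01)
    (\sum_i q i t + offzero eps t + m * \1_(zero_set u) t)%:E)%E.
  rewrite /A -(Rintegral_zero_set_cst m Hu).
  have -> : \sum_i (2 * P v i - P u i) = \int[mu]_(t in I01) (\sum_i q i t).
    rewrite Rintegral_finsum//; apply: eq_bigr => i _.
    have I1 := sqint_mul (Lwd u i Hu) (Lwd v i Hv).
    have [_ I2] := Lwd u i Hu.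
    rewrite /q RintegralB ?RintegralZl//.
    exact: eq_integrable (integrableZl measurable_I01 2 I1).
  rewrite -RintegralD// -RintegralD//.
  by rewrite /Rintegral fineK//; exact: integrable_fin_num Iall.
apply: ae_le_integral.
- by have /integrableP[] := Iall.
- exact: measurable_Geps_integrand.
have [_ vc] := continuous_reprP Hv.
apply: aeS vc => t vt It; rewrite lee_fin -addrA lerD//.
  rewrite enorm_sqr; apply: ler_sum => i _; rewrite /q.
  rewrite -subr_ge0.
  have -> : wd v t ord0 i ^+ 2 - (2 * (wd u t ord0 i * wd v t ord0 i) - wd u t ord0 i ^+ 2) =
     (wd v t ord0 i - wd u t ord0 i) ^+ 2 by ring.
  exact: sqr_ge0.
rewrite /offzero -/v vt// indicE; case: (_ \in _) => /=.
  by rewrite subrr mulr0 add0r mulr1.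
by rewrite subr0 mulr1 mulr0 addr0.
Unshelve. all: by end_near. Qed.

End LimInf.

(** * The Gamma-limit *)

Theorem theorem6p1 (R : realType) (d : nat) (d_ge1 : (1 <= d)%N)
    (W : 'rV[R]_d -> R)
    (W_borel : borel_fun W)
    (W_le0 : forall x : 'rV[R]_d, W x <= 0)
    (W_lim : vanishes_at_infinity W)
    (u : R -> 'rV[R]_d) (u_H1 : H1 u)
    (formula_defined : (infW W *? lebesgue_measure (zero_set u))%E) :
  is_Gamma_lim_at (Geps W) u
    (\int[lebesgue_measure]_(t in I01)
        (enorm (weak_derivative u t) ^+ 2)%:E
     + infW W * lebesgue_measure (zero_set u))%E.
Proof.
have Zfin := measure_zero_set_fin u_H1.
have Ifin : (\int[lebesgue_measure]_(t in I01) (enorm (weak_derivative u t) ^+ 2)%:E)%E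
    \is a fin_num.
  apply: integrable_fin_num; first exact: measurable_I01.
  exact: L2_enorm_integrable (H1_weak_L2 u_H1).
have infW_le x : (infW W <= (W x)%:E)%E by apply: ereal_inf_lbound; exists x.
have Z0 : (0 <= lebesgue_measure (zero_set u))%E by exact: measure_ge0.
split=> [ueps Hue uc|].
  case E : (infW W) => [m| |].
  - have Wm x : m <= W x by rewrite -lee_fin -E.
    have := liminf_inequality W_borel W_le0 Wm W_lim u_H1 Hue uc.
    by rewrite EFinD EFinM /Rintegral !fineK.
  - by have := infW_le 0; rewrite E.
  - have Zpos : (0 < lebesgue_measure (zero_set u))%E.
      rewrite lt0e Z0 andbT; apply/eqP => Z_0.
      by move: formula_defined; rewrite E Z_0 /mule_def /= eqxx.
    by rewrite gt0_mulNye// addeNy leNye.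
have [ueps [Hue uc sup]] := limsup_inequality W_borel W_le0 u_H1.
exists ueps; split=> //.
set L := limf_esup _ _ in sup *.
have {}sup x : (L - \int[lebesgue_measure]_(t in I01) (enorm (weak_derivative u t) ^+ 2)%:E <=
    (W x)%:E * lebesgue_measure (zero_set u))%E.
  by have := sup x; rewrite EFinD EFinM /Rintegral !fineK// leeBlDl.
rewrite -leeBlDl//.
have [Z_0|Zneq0] := eqVneq (lebesgue_measure (zero_set u)) 0%E.
  by have := sup 0; rewrite Z_0 !mule0.
have Zpos : 0 < fine (lebesgue_measure (zero_set u)).
  by rewrite fine_gt0// lt0e Zneq0 Z0 ltey_eq Zfin.
rewrite -(fineK Zfin) -lee_pdivrMr//.
by apply: le_ereal_inf_tmp => _ [x _ <-]; rewrite lee_pdivrMr// fineK.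
Qed.
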